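(* Let $F$ be a monotonic (decreasing) Boolean function given by a BDD with root variable $r$, let $S$ be the two-clauses-per-node encoding of this BDD (defined in the context), and let $S'$ be obtained from $S$ by adding the unit clause $r$ forcing the variable of the root node to be true. Then $S'$ is generalized arc-consistent: for every partial assignment $A$ to the variables of $F$ that can be extended to a model of $F$, and every variable $x_i$ of $F$ such that $A\cup\{x_i\}$ cannot be extended to a model of $F$, unit propagation on $S'$ and $A$ produces $\overline{x}_i$.
   Context: A Boolean function $F:\{0,1\}^k\to\{0,1\}$ is monotonic (decreasing) if every solution of $F$ (input with value 1) remains a solution after changing inputs from 1 to 0. A BDD here is a rooted binary decision diagram with terminals True and False in which every variable is tested at most once on each path (e.g. an ordered BDD with any variable ordering); it need not be reduced. Each nonterminal node has a selector variable, a false child and a true child. Two-clauses-per-node encoding: introduce one auxiliary variable for every node (terminals included; $r$ is the auxiliary variable of the root). For each nonterminal node with selector variable $x$, auxiliary variable $u$, and auxiliary variables $f$ and $t$ of its false child and true child, add the two clauses $\overline{f}\to\overline{u}$ (i.e. $f\vee\overline{u}$) and $\overline{t}\wedge x\to\overline{u}$ (i.e. $t\vee\overline{x}\vee\overline{u}$). In addition, add a unit clause consisting of the variable of the True node and a unit clause consisting of the negation of the variable of the False node. A partial assignment is a set of literals containing no pair $x,\overline{x}$; a model of $F$ is a total assignment on which $F$ has value 1. Unit propagation on a CNF $S$ and an assignment $A$: repeatedly, if some clause of $S$ has all its literals false except one undefined literal $l$, add $l$ to the assignment; a literal already in the assignment counts as produced. *)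

(* Defs.v *)
From mathcomp Require Import all_boot.

Set Implicit Arguments.
Unset Strict Implicit.
Unset Printing Implicit Defensive.

(** [(v, true)] is the literal v, [(v, false)] is its negation. *)
Definition literal (V : finType) : finType := (V * bool)%type.
Definition pos (V : finType) (v : V) : literal V := (v, true).
Definition neg (V : finType) (v : V) : literal V := (v, false).
Definition compl (V : finType) (l : literal V) : literal V := (l.1, ~~ l.2).

Definition clause (V : finType) : finType := {set literal V}.
Definition cnf (V : finType) : finType := {set clause V}.

Definition partial_assignment (V : finType) (A : {set literal V}) : Prop :=
  forall l, l \in A -> compl l \notin A.

Definition unit_under (V : finType) (A : {set literal V}) (C : clause V)
    (l : literal V) : bool :=
  [&& l \in C, l \notin A, compl l \notin A
    & [forall l' in C, (l' != l) ==> (compl l' \in A)]].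

Definition up_step (V : finType) (S : cnf V) : rel {set literal V} :=
  fun A B => [exists C in S, [exists l, unit_under A C l && (B == l |: A)]].

Definition up_result (V : finType) (S : cnf V) (A B : {set literal V}) : Prop :=
  connect (up_step S) A B /\ forall B', ~~ up_step S B B'.

(** The outcome may depend on the order of the propagations when a conflict
    occurs, so the literal is required to be produced for every order;
    [up_result_exists] shows that the quantification is not vacuous. *)
Definition up_produces (V : finType) (S : cnf V) (A : {set literal V})
    (l : literal V) : Prop :=
  forall B, up_result S A B -> l \in B.

Lemma up_step_card (V : finType) (S : cnf V) (A B : {set literal V}) :
  up_step S A B -> #|B| = #|A|.+1.
Proof.
case/existsP=> C /andP[_ /existsP[l /andP[/and4P[_ lA _ _] /eqP->]]].
by rewrite cardsU1 lA.
Qed.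

Lemma up_result_exists (V : finType) (S : cnf V) (A : {set literal V}) :
  exists B, up_result S A B.
Proof.
have [n] := ubnP (#|{: literal V}| - #|A|); elim: n A => // n IHn A ltAn.
have [/existsP[B sAB]|] := boolP [exists B, up_step S A B]; last first.
  by rewrite negb_exists => /forallP stA; exists A; split.
have cB := up_step_card sAB; have := max_card B; rewrite cB => ltA.
have [|B' [cBB' stB']] := IHn B.
  by rewrite -ltnS cB (leq_trans _ ltAn) // ltnS subnSK.
by exists B'; split=> //; apply: connect_trans (connect1 sAB) cBB'.
Qed.

Definition bool_fun (k : nat) : Type := {ffun 'I_k -> bool} -> bool.

Definition decreasing (k : nat) (F : bool_fun k) : Prop :=
  forall a b : {ffun 'I_k -> bool}, F a -> (forall i, b i -> a i) -> F b.

Definition extends_to_model (k : nat) (F : bool_fun k)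
    (A : {set literal 'I_k}) : Prop :=
  exists2 a : {ffun 'I_k -> bool}, (forall l, l \in A -> a l.1 = l.2) & F a.

(** [inp i] is the variable of the CNF that stands for the i-th input. *)
Definition lift_literals (k : nat) (V : finType) (inp : 'I_k -> V)
    (A : {set literal 'I_k}) : {set literal V} :=
  [set ((inp l.1, l.2) : literal V) | l in A].

(** Only the propagation of negative literals is required: a decreasing
    function never forces an unassigned input to be true. *)
Definition generalized_arc_consistent (k : nat) (V : finType)
    (inp : 'I_k -> V) (F : bool_fun k) (S : cnf V) : Prop :=
  forall (A : {set literal 'I_k}) (i : 'I_k),
    partial_assignment A -> extends_to_model F A ->
    ~ extends_to_model F (pos i |: A) ->
    up_produces S (lift_literals inp A) (neg (inp i)).

(** A node is [inl n] for a nonterminal [n], or one of the two terminals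
    [inr true] and [inr false]. *)
Record diagram (k : nat) : Type := Diagram {
  inner : finType;
  selector : inner -> 'I_k;
  false_child : inner -> inner + bool;
  true_child : inner -> inner + bool;
  root : inner + bool
}.

Definition node (k : nat) (D : diagram k) : finType := (inner D + bool)%type.

Definition terminal (k : nat) (D : diagram k) (b : bool) : node D := inr b.

Definition child (k : nat) (D : diagram k) : rel (node D) :=
  fun u v => if u is inl n then (v == false_child n) || (v == true_child n)
             else false.

Definition tested (k : nat) (D : diagram k) (p : seq (node D)) : seq 'I_k :=
  pmap (fun u : node D => if u is inl n then Some (selector n) else None) p.

(** Nodes that are not reachable from the root are allowed; the read-once
    condition only concerns paths that start at the root. *)
Definition is_bdd (k : nat) (D : diagram k) : Prop :=
  (forall u v : node D, child u v -> ~~ connect (@child k D) v u) /\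
  (forall p : seq (node D), path (@child k D) (root D) p ->
     uniq (tested (root D :: p : seq (node D)))).

Definition follow (k : nat) (D : diagram k) (a : {ffun 'I_k -> bool})
    (u : node D) : node D :=
  match u with
  | inl n => if a (selector n) then true_child n else false_child n
  | inr b => inr b
  end.

(** Terminals are fixed by [follow], so at most one of them is reached. *)
Definition computes (k : nat) (D : diagram k) (F : bool_fun k) : Prop :=
  forall a, fconnect (@follow k D a) (root D) (terminal D (F a)).

(** Input variables are on the left, auxiliary variables on the right. *)
Definition enc_var (k : nat) (D : diagram k) : finType := ('I_k + node D)%type.

Definition input (k : nat) (D : diagram k) (i : 'I_k) : enc_var D := inl i.
Definition aux (k : nat) (D : diagram k) (u : node D) : enc_var D := inr u.

Definition false_clause (k : nat) (D : diagram k) (n : inner D)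
    : clause (enc_var D) :=
  [set pos (aux (false_child n : node D)); neg (aux (inl n : node D))].

Definition true_clause (k : nat) (D : diagram k) (n : inner D)
    : clause (enc_var D) :=
  [set pos (aux (true_child n : node D)); neg (input D (selector n));
       neg (aux (inl n : node D))].

Definition encoding (k : nat) (D : diagram k) : cnf (enc_var D) :=
  [set false_clause n | n : inner D] :|: [set true_clause n | n : inner D]
  :|: [set [set pos (aux (terminal D true))];
           [set neg (aux (terminal D false))]].

Definition rooted_encoding (k : nat) (D : diagram k) : cnf (enc_var D) :=
  [set pos (aux (root D : node D))] |: encoding D.

(* Main.v *)
(** Give the auxiliary variable of u the value true iff False cannot be reached
    from u by following false edges freely and true edges only at inputs set
    by a.  If a is a model of F this satisfies all clauses: such a path from
    the root would, by read-once, be the evaluation path of an assignment below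
    a, where F is true by monotonicity.  Hence propagation from a consistent A
    never meets a conflict.

    Now let b set exactly the inputs that A sets and x_i.  It is not a model,
    so its evaluation path leads to False.  The unit clause of the root is
    propagated down this path, and that of False up this path, as long as x_i
    is not tested; they meet at the only node that tests x_i, where the second
    clause of the node becomes the unit clause for the negation of x_i. *)

Require Import Defs.
From mathcomp Require Import all_boot.

Set Implicit Arguments.
Unset Strict Implicit.
Unset Printing Implicit Defensive.

Definition satisfies (V : finType) (s : V -> bool) (C : clause V) : Prop :=
  exists2 l, l \in C & s l.1 = l.2.

(** * Unit propagation on a clause set with a model [s] *)

Section UnitPropagation.

Variables (V : finType) (S : cnf V) (s : V -> bool).
Hypothesis satS : forall C, C \in S -> satisfies s C.

Lemma up_connect_sub (A B : {set literal V}) :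
  connect (up_step S) A B -> A \subset B.
Proof.
case/connectP=> p; elim: p A => [|A' p IHp] A /= => [_ ->//|/andP[stA pthp] eB].
apply: subset_trans (IHp _ pthp eB).
by case/existsP: stA => C /andP[_ /existsP[l /andP[_ /eqP->]]]; apply: subsetUr.
Qed.

Lemma up_connect_sound (A B : {set literal V}) :
    connect (up_step S) A B ->
  {in A, forall l, s l.1 = l.2} -> {in B, forall l, s l.1 = l.2}.
Proof.
case/connectP=> p; elim: p A => [|A' p IHp] A /= => [_ ->//|/andP[stA pthp] eB].
move=> sA; apply: (IHp _ pthp eB) => m.
case/existsP: stA => C /andP[CS /existsP[l /andP[uC /eqP->]]].
case/setU1P=> [->|]; last exact: sA.
have [l' l'C sl'] := satS CS; case/and4P: uC => _ _ _ /forall_inP/(_ l' l'C).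
case: eqP => [<-//|_ /= /sA /= sN].
by move: sN; rewrite sl'; case: (l'.2).
Qed.

(** Suppose [l] is missing. If [compl l] is in [B], then [s] falsifies every literal of [C]; if not,
    [C] is unit and [B] admits another step. *)
Lemma up_result_unit (A B : {set literal V}) (C : clause V) (l : literal V) :
    up_result S A B -> {in B, forall l, s l.1 = l.2} -> C \in S -> l \in C ->
    {in C, forall l', l' != l -> compl l' \in B} ->
  l \in B.
Proof.
move=> [_ stB] sB CS lC othC; apply/negPn/negP => lB.
have clB : compl l \notin B.
  apply/negP => clB; have [l' l'C sl'] := satS CS.
  have cl'B : compl l' \in B by case: (eqVneq l' l) => [->|/(othC _ l'C)].
  by move: (sB _ cl'B); rewrite /= sl'; case: (l'.2).
case/negP: (stB (l |: B)); apply/existsP; exists C; rewrite CS /=.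
apply/existsP; exists l; rewrite eqxx andbT; apply/and4P; split=> //.
by apply/forall_inP => l' l'C; apply/implyP; apply: othC.
Qed.

End UnitPropagation.

(** * Paths in the diagram and a model of the encoding *)

Section Encoding.

Variables (k : nat) (D : diagram k).

Implicit Types (a b : {ffun 'I_k -> bool}) (u v w : node D) (p : seq (node D)).

Lemma tested_cons u p : {subset tested p <= tested (u :: p)}.
Proof. by case: u => [n|c] x //=; rewrite inE => ->; rewrite orbT. Qed.

Lemma mem_tested (n : inner D) p :
  (inl n : node D) \in p -> selector n \in tested p.
Proof.
elim: p => // u p IHp; rewrite inE => /predU1P[<-|/IHp /tested_cons //].
by rewrite /= inE eqxx.
Qed.

Lemma eq_fpath_follow a b u p :
    {in tested (u :: p), a =1 b} ->
  fpath (follow a) u p -> fpath (follow b) u p.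
Proof.
move=> eab; apply: (@sub_in_path _ (mem (u :: p))); last exact/allP.
move=> [n|c] w //= nP _ /eqP<-.
by rewrite /= eab // mem_tested.
Qed.

Definition down a : rel (node D) := fun u v =>
  if u is inl n then
    (v == false_child n) || (a (selector n) && (v == true_child n))
  else false.

Lemma down_child a : subrel (down a) (@child k D).
Proof. by case=> [n|c] v //= /orP[->//|/andP[_ ->]]; rewrite orbT. Qed.

(** [b] is built from the end of the path. It vanishes on inputs not tested there, so an earlier
    node, whose selector is not tested again, takes its false edge by default. *)
Lemma down_path_follow a u p :
    path (down a) u p -> uniq (tested (u :: p)) ->
  exists b, [/\ forall i, b i -> a i,
    {in [predC tested (u :: p)], forall i, ~~ b i} & fpath (follow b) u p].
Proof.
elim: p u => [|v p IHp] u /=.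
  by move=> _ _; exists [ffun=> false]; split=> // i; rewrite ffunE.
case: u => [n|c] //= /andP[uv pthp] /andP[n_p uniqp].
have [b [leba b0 fp]] := IHp v pthp uniqp.
(* If both children coincide, the edge counts as a false edge and [b] is kept. *)
case: (eqVneq v (false_child n)) uv => [ev _|_ /= /andP[an /eqP ev]].
  exists b; split=> // [i|].
    by rewrite !inE negb_or => /andP[_ ip]; apply: b0.
  by rewrite (negPf (b0 (selector n) n_p)) ev eqxx -ev.
(* Setting the selector leaves the rest of the path intact, since it is not tested there. *)
exists [ffun i => (i == selector n) || b i]; split=> [i|i|].
- by rewrite ffunE => /predU1P[->|/leba].
- rewrite !inE negb_or ffunE => /andP[/negPf-> ip]; exact: b0.
rewrite ffunE eqxx ev /= eqxx -ev; apply: eq_fpath_follow fp => i ip.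
by rewrite ffunE; case: eqP ip n_p => // -> ->.
Qed.

Lemma fconnect_terminal a u c d :
    fconnect (follow a) u (terminal D c) ->
    fconnect (follow a) u (terminal D d) ->
  c = d.
Proof.
have fixT e m : iter m (follow a) (terminal D e) = terminal D e.
  by elim: m => //= m ->.
move=> /iter_findex ec /iter_findex ed.
set m := findex _ _ _ in ec; set n := findex _ _ _ in ed.
have: terminal D c = terminal D d.
  by rewrite -(fixT c n) -(fixT d m) -{1}ec -ed -!iterD addnC.
by case.
Qed.

Lemma encoding_satisfied (F : bool_fun k) a :
    decreasing F -> is_bdd D -> computes D F -> F a ->
  exists2 s : enc_var D -> bool, (forall i, s (input D i) = a i)
    & forall C, C \in rooted_encoding D -> satisfies s C.
Proof.
move=> hF [_ once] hDF Fa.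
pose s (x : enc_var D) := match x with
  | inl i => a i
  | inr u => ~~ connect (down a) u (terminal D false)
  end.
exists s => // C.
case/setU1P=> [->|].
  exists (pos (aux (Defs.root D : node D))); first by rewrite inE.
  apply/negP => /connectP[p pthp eF].
  have [b [leba _ fp]] : exists b, [/\ forall i, b i -> a i,
      {in [predC tested ((Defs.root D : node D) :: p)], forall i, ~~ b i}
      & fpath (follow b) (Defs.root D : node D) p].
    exact: down_path_follow pthp (once _ (sub_path (@down_child a) pthp)).
  have bF : fconnect (follow b) (Defs.root D : node D) (terminal D false).
    by apply/connectP; exists p.
  by have := fconnect_terminal (hDF b) bF; rewrite (hF a b Fa leba).
case/setUP=> [/setUP[]/imsetP[n _ ->]|].
(* If the child can reach False, so can the node, and the negative literal of the node holds. *)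
- case sf: (s (aux (false_child n : node D))).
    by exists (pos (aux (false_child n : node D))); rewrite ?inE ?eqxx.
  exists (neg (aux (inl n : node D))); rewrite ?inE ?eqxx ?orbT //=.
  apply/negPn; move/negbFE: sf; apply: connect_trans.
  by apply: connect1; rewrite /= eqxx.
- case st: (s (aux (true_child n : node D))).
    by exists (pos (aux (true_child n : node D))); rewrite ?inE ?eqxx.
  case an: (a (selector n)); last first.
    by exists (neg (input D (selector n))); rewrite ?inE ?eqxx ?orbT.
  exists (neg (aux (inl n : node D))); rewrite ?inE ?eqxx ?orbT //=.
  apply/negPn; move/negbFE: st; apply: connect_trans.
  by apply: connect1; rewrite /= an eqxx orbT.
case/set2P=> ->.
  exists (pos (aux (terminal D true))); first by rewrite inE.
  (* No edge leaves a terminal. *)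
  by apply/negP => /connectP[[|v p]].
exists (neg (aux (terminal D false))); first by rewrite inE.
by rewrite /= connect0.
Qed.

(** Intersecting with [child] removes the loops of [follow] at the terminals, so that the read-once
    condition applies to these paths. *)
Definition eval_edge b : rel (node D) :=
  fun u v => child u v && (follow b u == v).

Lemma fconnect_eval_edge b u v :
  fconnect (follow b) u v -> connect (eval_edge b) u v.
Proof.
apply: connect_sub => {u v} [[n|c]] v /eqP <-; last exact: connect0.
apply: connect1; rewrite /eval_edge eqxx andbT /=.
by case: (b _); rewrite eqxx ?orbT.
Qed.

(** * Propagation along an evaluation path *)

Section PropagationFixpoint.

Variables (A B : {set literal (enc_var D)}) (s : enc_var D -> bool).
Hypothesis satS : forall C, C \in rooted_encoding D -> satisfies s C.
Hypothesis upB : up_result (rooted_encoding D) A B.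
Hypothesis sB : {in B, forall l, s l.1 = l.2}.

Let unitB C l := @up_result_unit _ _ s satS A B C l upB sB.

Lemma root_up : pos (aux (Defs.root D : node D)) \in B.
Proof.
apply: (unitB (C := [set pos (aux (Defs.root D : node D))])).
- by rewrite !inE eqxx.
- by rewrite inE.
- by move=> l; rewrite inE => ->.
Qed.

Lemma false_up : neg (aux (terminal D false)) \in B.
Proof.
apply: (unitB (C := [set neg (aux (terminal D false))])).
- by rewrite !inE eqxx !orbT.
- by rewrite inE.
- by move=> l; rewrite inE => ->.
Qed.

Lemma false_clause_in n : false_clause n \in rooted_encoding D.
Proof. by rewrite !inE imset_f ?inE ?orbT. Qed.

Lemma true_clause_in n : true_clause n \in rooted_encoding D.
Proof. by rewrite !inE (imset_f (@true_clause k D)) ?inE ?orbT. Qed.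

Lemma false_child_down (n : inner D) :
    pos (aux (inl n : node D)) \in B ->
  pos (aux (false_child n : node D)) \in B.
Proof.
move=> nB; apply: (unitB (false_clause_in n)); first by rewrite !inE eqxx.
by move=> l; rewrite !inE => /orP[]/eqP-> //; rewrite eqxx.
Qed.

Lemma false_child_up (n : inner D) :
    neg (aux (false_child n : node D)) \in B ->
  neg (aux (inl n : node D)) \in B.
Proof.
move=> nB; apply: (unitB (false_clause_in n)); first by rewrite !inE eqxx orbT.
by move=> l; rewrite !inE => /orP[]/eqP-> //; rewrite eqxx.
Qed.

Lemma true_child_down (n : inner D) :
    pos (input D (selector n)) \in B -> pos (aux (inl n : node D)) \in B ->
  pos (aux (true_child n : node D)) \in B.
Proof.
move=> xB nB; apply: (unitB (true_clause_in n)); first by rewrite !inE eqxx.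
by move=> l; rewrite !inE => /orP[/orP[]|]/eqP-> //; rewrite eqxx.
Qed.

Lemma true_child_up (n : inner D) :
    pos (input D (selector n)) \in B ->
    neg (aux (true_child n : node D)) \in B ->
  neg (aux (inl n : node D)) \in B.
Proof.
move=> xB nB; apply: (unitB (true_clause_in n)).
  by rewrite !inE eqxx orbT.
by move=> l; rewrite !inE => /orP[/orP[]|]/eqP-> //; rewrite eqxx.
Qed.

Lemma selector_neg (n : inner D) :
    pos (aux (inl n : node D)) \in B ->
    neg (aux (true_child n : node D)) \in B ->
  neg (input D (selector n)) \in B.
Proof.
move=> uB nB; apply: (unitB (true_clause_in n)).
  by rewrite !inE eqxx !orbT.
by move=> l; rewrite !inE => /orP[/orP[]|]/eqP-> //; rewrite eqxx.
Qed.

Variables (b : {ffun 'I_k -> bool}) (i : 'I_k).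
Hypothesis bi : b i.
Hypothesis bB : forall j, j != i -> b j -> pos (input D j) \in B.

(** Induction from False upwards. The false clause mentions no input, so a false edge propagates
    even if its selector is unassigned; at a true edge the selector is not [i], and [bB] applies. *)
Lemma eval_path_up u p :
    path (eval_edge b) u p -> last u p = terminal D false ->
    i \notin tested (u :: p) ->
  neg (aux u) \in B.
Proof.
elim: p u => [|v p IHp] u /= => [_ -> _|]; first exact: false_up.
case: u => [n|c] //= /andP[/andP[_ /eqP ev] pthp] lastp.
rewrite inE negb_or eq_sym => /andP[ni ip].
have vB := IHp v pthp lastp ip; rewrite -ev /= in vB.
case bn: (b (selector n)) vB => vB; last exact: false_child_up.
by apply: true_child_up => //; apply: bB.
Qed.

Lemma eval_path_meet u p :
    path (eval_edge b) u p -> last u p = terminal D false ->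
    uniq (tested (u :: p)) -> pos (aux u) \in B ->
  neg (input D i) \in B.
Proof.
(* The descent cannot arrive at False: both literals of its variable would be in [B], against [s].
   Hence the path tests [i]. *)
elim: p u => [|v p IHp] u /= => [_ -> _ /sB|].
  by rewrite /= (sB false_up).
case: u => [n|c] //= /andP[/andP[_ /eqP ev] pthp] lastp /andP[n_p uniqp] uB.
have [ni|ni] := eqVneq (selector n) i.
  rewrite -ni; apply: selector_neg => //.
  (* By read-once, [i] is not tested below this node. *)
  rewrite /= ni bi in ev; rewrite ev; apply: eval_path_up pthp lastp _.
  by rewrite -ni.
apply: IHp pthp lastp uniqp _; rewrite -ev /=.
case bn: (b (selector n)); last exact: false_child_down.
by apply: true_child_down => //; apply: bB.
Qed.

End PropagationFixpoint.

End Encoding.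

Theorem theorem23 (k : nat) (F : bool_fun k) (D : diagram k)
    (hF : decreasing F) (hD : is_bdd D) (hDF : computes D F) :
  generalized_arc_consistent (input D) F (rooted_encoding D).
Proof.
move=> A i pA [a aA Fa] nexA B upB.
have [s sa satS] := encoding_satisfied hF hD hDF Fa.
have AB : {in A, forall l, ((input D l.1, l.2) : literal (enc_var D)) \in B}.
  move=> l lA; apply: (subsetP (up_connect_sub upB.1)).
  by apply: (imset_f (fun l : literal 'I_k => (input D l.1, l.2))).
have sB : {in B, forall l, s l.1 = l.2}.
  apply: (up_connect_sound satS upB.1) => _ /imsetP[l lA ->] /=.
  by rewrite sa aA.
have [/AB //|niA] := boolP (neg i \in A).
(* Inputs left open by [A], other than [i], become false. *)
pose b := [ffun j => (j == i) || (pos j \in A)].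
have bF : F b = false.
  apply/negP => Fb; apply: nexA; exists b => // l.
  rewrite ffunE => /setU1P[->|lA]; first by rewrite eqxx.
  case: l lA => j [] lA /=; first by rewrite lA orbT.
  (* For a negative literal of [A], [niA] excludes the index [i] and consistency of [A] excludes the
     positive literal. *)
  apply/norP; split; first by apply: contraNneq niA => <-.
  exact: pA lA.
have := fconnect_eval_edge (hDF b); rewrite bF => conn.
case/connectP: conn => p pthp lastp.
apply: (eval_path_meet satS upB sB (b := b) _ _ pthp (esym lastp)).
- by rewrite ffunE eqxx.
- by move=> j /negPf ji; rewrite ffunE ji => /AB.
- by apply: (hD.2); apply: sub_path pthp => u v /andP[].
- exact: root_up satS upB sB.
Qed.
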